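(* Let $G$ and $H$ be locally compact groups. Let $T:\mathcal{C}_c(G)\rightarrow\mathcal{C}_c(H)$ be an algebra isomorphism under pointwise and convolution products (that is, $T$ is an isomorphism of algebras both from $(\mathcal{C}_c(G),+,\cdot)$ onto $(\mathcal{C}_c(H),+,\cdot)$ and from $(\mathcal{C}_c(G),+,\ast)$ onto $(\mathcal{C}_c(H),+,\ast)$). Then there exists a multiplicative homeomorphism $\psi:H\rightarrow G$ such that either $Tf(y)=\overline{f(\psi(y))}$ for all $f\in\mathcal{C}_c(G)$ and all $y\in H$, or $Tf(y)=f(\psi(y))$ for all $f\in\mathcal{C}_c(G)$ and all $y\in H$.
   Context: Locally compact groups are assumed Hausdorff. For a locally compact group $G$, $\mathcal{C}_c(G)$ is the set of compactly supported continuous functions $f:G\to\mathbb{C}$. Fix a left Haar measure $\mu$ on $G$ (and likewise on $H$). The convolution product of $f,g\in\mathcal{C}_c(G)$ is $(f\ast g)(x)=\int_G f(xy^{-1})\,g(y)\,d\mu(y)$. $(\mathcal{C}_c(G),+,\cdot)$ denotes $\mathcal{C}_c(G)$ with pointwise addition and pointwise multiplication, and $(\mathcal{C}_c(G),+,\ast)$ denotes $\mathcal{C}_c(G)$ with pointwise addition and convolution. A multiplicative homeomorphism $\psi:H\to G$ is a homeomorphism that satisfies $\psi(xy)=\psi(x)\psi(y)$ for all $x,y\in H$. The bar denotes complex conjugation. *)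

(* Defs.v *)
From HB Require Import structures.
From mathcomp Require Import all_boot all_order all_algebra.
From mathcomp Require Import all_classical all_reals all_analysis.
From mathcomp.real_closed Require Export complex.

Set Implicit Arguments.
Unset Strict Implicit.
Unset Printing Implicit Defensive.
Import Order.TTheory GRing.Theory Num.Theory.
Import numFieldNormedType.Exports.

Local Open Scope classical_set_scope.
Local Open Scope ring_scope.
Local Open Scope complex_scope.

HB.mixin Record isTopologicalGroup G & Group G & Topological G := {
  mulg_continuous : continuous (fun p : G * G => (p.1 * p.2)%g) ;
  invg_continuous : continuous (fun x : G => x^-1%g)
}.

(* The distinguished point carried by [PointedTopological] is arbitrary and
   unrelated to the group structure; it is there because [measurableType]s
   are pointed. *)
#[short(type="topologicalGroupType")]
HB.structure Definition TopologicalGroup :=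
  {G of Group G & PointedTopological G & isTopologicalGroup G}.

Definition locally_compact_group (G : topologicalGroupType) : Prop :=
  hausdorff_space G /\ locally_compact [set: G].

Definition borel (G : topologicalGroupType) := g_sigma_algebraType (@open G).

(* Radon in the sense: finite on compact sets, outer regular on Borel sets,
   inner regular on open sets. *)
Definition left_haar_measure (R : realType) (G : topologicalGroupType)
    (mu : {measure set (borel G) -> \bar R}) : Prop :=
  [/\ (mu setT != 0)%E,
      forall K : set G, compact K -> (mu K < +oo)%E,
      forall A : set (borel G), measurable A ->
        mu A = ereal_inf [set mu U | U in [set U : set G | open U /\ A `<=` U]],
      forall U : set G, open U ->
        mu U = ereal_sup [set mu K | K in [set K : set G | compact K /\ K `<=` U]] &
      forall (x : G) (A : set (borel G)), measurable A ->
        mu [set (x * y)%g | y in A] = mu A].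

(* [R[i]^o] carries the topology of the norm of the field [R[i]]. *)
Definition Cc (R : realType) (G : topologicalGroupType) : set (G -> R[i]) :=
  [set f | continuous (f : G -> R[i]^o) /\
           compact (closure [set x | f x != 0])].

Definition complex_integral (R : realType) (G : topologicalGroupType)
    (mu : {measure set (borel G) -> \bar R}) (f : G -> R[i]) : R[i] :=
  (\int[mu]_y complex.Re (f y)) +i* (\int[mu]_y complex.Im (f y)).

(* The measure is a left Haar measure and there is no modular factor. *)
Definition convolution (R : realType) (G : topologicalGroupType)
    (mu : {measure set (borel G) -> \bar R}) (f g : G -> R[i]) : G -> R[i] :=
  fun x => complex_integral mu (fun y => f (x * y^-1)%g * g y).

(* [T], restricted to [A], is an isomorphism of (A, +, mulA) onto (B, +, mulB);
   its values outside [A] are irrelevant. Linearity is over the reals: this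
   includes the complex linear isomorphisms, while also allowing the conjugate
   linear ones. *)
Definition algebra_isomorphism (R : realType) (X Y : Type)
    (A : set (X -> R[i])) (mulA : (X -> R[i]) -> (X -> R[i]) -> (X -> R[i]))
    (B : set (Y -> R[i])) (mulB : (Y -> R[i]) -> (Y -> R[i]) -> (Y -> R[i]))
    (T : (X -> R[i]) -> (Y -> R[i])) : Prop :=
  [/\ set_bij A B T,
      forall f g, A f -> A g -> T (f \+ g) = T f \+ T g,
      forall (a : R) f, A f -> T (fun x => a%:C * f x) = (fun y => a%:C * T f y) &
      forall f g, A f -> A g -> T (mulA f g) = mulB (T f) (T g)].

Definition pointwise_product (R : realType) (X : Type) (f g : X -> R[i]) :
  X -> R[i] := f \* g.

Definition homeomorphism (X Y : topologicalType) (f : X -> Y) : Prop :=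
  continuous f /\
  exists g : Y -> X, [/\ cancel f g, cancel g f & continuous g].

Definition multiplicative_homeomorphism (H G : topologicalGroupType)
    (psi : H -> G) : Prop :=
  homeomorphism psi /\ forall x y : H, psi (x * y)%g = (psi x * psi y)%g.

(* Main.v *)
(* Fix [y] in [H]: [f |-> T f y] is a real algebra homomorphism of C_c(G) onto the
   complex numbers. A compactness argument shows that the functions it kills have a
   common zero [psi y], so it factors through the evaluation at [psi y], and the
   factor is a real automorphism of the complex numbers: the identity or the
   conjugation. The same construction for the inverse of [T] inverts [psi].
   For real functions the two convolutions are thus related by
     int u(psi x y^-1) v(y) dmuG(y) = int u(psi(x y^-1)) v(psi y) dmuH(y),
   and bump functions [u], [v] force [psi x (psi y)^-1 = psi(x y^-1)], as Haar
   measures charge open sets. If [T(iu) = s i (u o psi)] with [s] a function of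
   values 1 and -1, then convolving [iu] with real [v] gives
     s(x) int u(psi(x y^-1)) v(psi y) dmuH(y)
       = int s(x y^-1) u(psi(x y^-1)) v(psi y) dmuH(y),
   and bump functions again force [s] to be constant. *)

Require Import Defs.
From mathcomp Require Import all_boot all_order all_algebra.
From mathcomp Require Import all_classical all_reals all_analysis.
From mathcomp Require Import measurable_realfun.
Import Order.TTheory GRing.Theory Num.Theory.
Import numFieldNormedType.Exports.
Set Implicit Arguments.
Unset Strict Implicit.
Unset Printing Implicit Defensive.
Local Open Scope classical_set_scope.
Local Open Scope ring_scope.
Local Open Scope complex_scope.

(** * Continuity of complex functions through real and imaginary parts *)

Lemma norm_complex_real (R : realType) (a : R) : `|a%:C| = `|a|%:C.
Proof. by rewrite normc_def /= expr0n addr0 sqrtr_sqr. Qed.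

Lemma norm_complex_i (R : realType) : `|'i : R[i]| = 1.
Proof. by rewrite normc_def /= expr0n expr1n add0r sqrtr1. Qed.

(** Both parts of [z] are bounded by [|z|], and [|z|] is at most the sum of their absolute
    values. *)
Lemma continuous_complexP (R : realType) (X : topologicalType) (f : X -> R[i]) :
  continuous (f : X -> R[i]^o) <->
  continuous (fun x => complex.Re (f x)) /\ continuous (fun x => complex.Im (f x)).
Proof.
split=> [cf|[cre cim]].
- split=> x; apply/cvgrPdist_lt => e e0 /=;
    have /cvgrPdist_lt/(_ e%:C) := cf x; rewrite ltcR => /(_ e0);
    apply: filterS => y /=; rewrite -ltcR; apply: le_lt_trans.
  + by rewrite -raddfB; exact: normc_ge_Re.
  + rewrite -raddfB; have := normc_ge_Re ((f x - f y) * 'i).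
    by rewrite ReiNIm normrN normrM norm_complex_i mulr1.
- move=> x; apply/cvgrPdist_lt => e e0.
  (* The radius [e] is a positive element of [R[i]], hence a real number. *)
  have e0i : complex.Im e = 0 by apply: ger0_Im; exact: ltW.
  have eE : e = (complex.Re e)%:C by rewrite [LHS]complexE e0i mulr0 addr0.
  have e0' : 0 < complex.Re e / 2 by rewrite divr_gt0// -ltcR -eE.
  have /cvgrPdist_lt/(_ _ e0') h1 := cre x.
  have /cvgrPdist_lt/(_ _ e0') h2 := cim x.
  near=> y; rewrite [_ - _]complexE (le_lt_trans (ler_normD _ _))// normrM.
  rewrite norm_complex_i mul1r !norm_complex_real -rmorphD /= eE ltcR.
  by rewrite (splitr (complex.Re e)) !raddfB ltrD//; near: y.
Unshelve. all: by end_near. Qed.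

(** * Real continuous functions of compact support *)

Definition Ccr (R : realType) (X : topologicalType) : set (X -> R) :=
  [set u | continuous u /\ compact (closure [set x | u x != 0])].

Section real_Cc.
Context (R : realType) (X : topologicalType).
Implicit Types (u v w : X -> R) (f g : X -> R[i]).

Lemma sub_compact_closure (A B : set X) :
  A `<=` B -> compact (closure B) -> compact (closure A).
Proof. by rewrite -!precompactE; exact: precompact_subset. Qed.

Lemma CcrM u w : Ccr u -> continuous w -> Ccr (fun x => u x * w x).
Proof.
move=> [cu ku] cw; split; first by move=> x; apply: cvgM; [exact: cu|exact: cw].
apply: sub_compact_closure ku => x /=.
by apply: contra_neq => ->; rewrite mul0r.
Qed.

Lemma CcrD u v : Ccr u -> Ccr v -> Ccr (fun x => u x + v x).
Proof.
move=> [cu ku] [cv kv]; split.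
  by move=> x; apply: cvgD; [exact: cu|exact: cv].
have := compactU ku kv; rewrite -closureU; apply: sub_compact_closure => x /=.
by have [->|] := eqVneq (u x) 0; [rewrite add0r; right|left].
Qed.

Lemma CcrZ (a : R) u : Ccr u -> Ccr (fun x => a * u x).
Proof.
move=> Cu; rewrite (_ : (fun _ => _) = (fun x => u x * a)); last first.
  by apply/funext => x; rewrite mulrC.
by apply: CcrM => // x; exact: cvg_cst.
Qed.

Lemma Ccr0 : Ccr (fun _ : X => 0 : R).
Proof.
split; first by move=> x; exact: cvg_cst.
rewrite (_ : [set _ | _] = set0) ?closure0; first exact: compact0.
by rewrite -subset0 => x /=; rewrite eqxx.
Qed.

(* [w] may vanish off the support of [u], where the quotient is [0]. *)
Lemma Ccr_div u w : Ccr u -> continuous w ->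
  (forall x, closure [set x | u x != 0] x -> w x != 0) ->
  Ccr (fun x => u x / w x).
Proof.
move=> [cu ku] cw uw; split; last first.
  by apply: sub_compact_closure ku => x /=; apply: contra_neq => ->; rewrite mul0r.
move=> x; have [/uw wx|nux] := pselect (closure [set x | u x != 0] x).
  by apply: cvgM; [exact: cu|apply: cvgV => //; exact: cw].
have ux y : ~ closure [set x | u x != 0] y -> u y = 0.
  by move=> h; apply: contrapT => /eqP uy; apply: h; exact: subset_closure.
have v0 y : ~ closure [set x | u x != 0] y -> u y / w y = 0.
  by move/ux ->; rewrite mul0r.
rewrite /continuous_at v0//; apply: cvg_near_cst.
have : nbhs x (~` closure [set x | u x != 0]).
  by apply: open_nbhs_nbhs; split => //; apply: closed_openC; exact: closed_closure.
by apply: filterS => y; exact: v0.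
Qed.

End real_Cc.

(** * Complex functions of compact support and bump functions *)

Section complex_Cc.
Context (R : realType) (G : topologicalGroupType).
Implicit Types (u v w : G -> R) (f g : G -> R[i]).

Lemma CcP f :
  Cc f <-> Ccr (fun x => complex.Re (f x)) /\ Ccr (fun x => complex.Im (f x)).
Proof.
split=> [[/continuous_complexP[cre cim] kf]|[[cre kre] [cim kim]]].
  by split; split => //; apply: sub_compact_closure kf => x /=;
    apply: contra_neq => ->.
split; first exact/continuous_complexP.
have := compactU kre kim; rewrite -closureU; apply: sub_compact_closure => x /=.
by rewrite eq_complex negb_and => /orP.
Qed.

Lemma Cc_real u : Ccr u -> Cc (fun x => (u x)%:C).
Proof. by move=> Cu; apply/CcP; split => //; exact: Ccr0. Qed.

Lemma Cc_imaginary u : Ccr u -> Cc (fun x => 0 +i* u x).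
Proof. by move=> Cu; apply/CcP; split => //; exact: Ccr0. Qed.

Lemma CcD f g : Cc f -> Cc g -> Cc (f \+ g).
Proof.
move=> /CcP[f1 f2] /CcP[g1 g2]; apply/CcP; split.
  by have := CcrD f1 g1; congr (Ccr _); apply/funext => x; rewrite raddfD.
by have := CcrD f2 g2; congr (Ccr _); apply/funext => x; rewrite raddfD.
Qed.

Lemma CcZ (a : R) f : Cc f -> Cc (fun x => a%:C * f x).
Proof.
move=> /CcP[f1 f2]; apply/CcP; split.
  have := CcrZ a f1; congr (Ccr _); apply/funext => x.
  by case: (f x) => c d /=; rewrite mul0r subr0.
have := CcrZ a f2; congr (Ccr _); apply/funext => x.
by case: (f x) => c d /=; rewrite mul0r addr0.
Qed.

Lemma CcM f g : Cc f -> Cc g -> Cc (f \* g).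
Proof.
move=> /CcP[f1 f2] /CcP[[g1 _] [g2 _]]; apply/CcP; split.
  have := CcrD (CcrM f1 g1) (CcrZ (-1) (CcrM f2 g2)); congr (Ccr _).
  by apply/funext => x /=; case: (f x) (g x) => a b [c d] /=; rewrite mulN1r.
have := CcrD (CcrM f1 g2) (CcrM f2 g1); congr (Ccr _).
by apply/funext => x /=; case: (f x) (g x) => a b [c d] /=.
Qed.

Lemma Cc_conj f : Cc f -> Cc (fun x => conjc (f x)).
Proof.
move=> /CcP[f1 f2]; apply/CcP; split.
  by move: f1; congr (Ccr _); apply/funext => x; case: (f x).
have := CcrZ (-1) f2; congr (Ccr _); apply/funext => x.
by case: (f x) => a b /=; rewrite mulN1r.
Qed.

(** Complete regularity separates [p] from the complement of the interior of [U] intersected with a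
    compact neighbourhood [V]. The bump is 1 minus the separating function; [V] makes its support
    compact. *)
Lemma Ccr_bump (p : G) (U : set G) : locally_compact_group G -> nbhs p U ->
  exists u : G -> R,
    [/\ Ccr u, forall x, 0 <= u x, 0 < u p & forall x, u x != 0 -> U x].
Proof.
move=> [hG lG] pU.
have [V pV [kV cV]] := lG p I.
rewrite withinET in pV.
set W := (U `&` V)^°.
have pW : W p by exact: filterI.
have /(@uniform_separatorP _ R)[f [cf f01 fp fW]] : uniform_separator [set p] (~` W).
  apply: (@locally_compact_completely_regular _ R lG hG).
    by apply: open_closedC; exact: open_interior.
  by apply.
have UV x : 1 - f x != 0 -> (U `&` V) x.
  move=> fx; apply: interior_subset; apply: contrapT => nWx.
  by move/eqP: fx; apply; rewrite (fW (f x)) ?subrr//; exists x.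
exists (fun x => 1 - f x); split.
- split; first by move=> x; apply: cvgB; [exact: cvg_cst|exact: cf].
  have kcV : compact (closure V) by rewrite -(closure_id V).1.
  by apply: sub_compact_closure kcV => x /UV[].
- move=> x; rewrite subr_ge0; have /= := f01 (f x); rewrite in_itv /=.
  by move=> h; have /andP[] : 0 <= f x <= 1 by apply: h; exists x.
- by rewrite (fp (f p)) ?subr0//; exists p.
- by move=> x /UV[].
Qed.

End complex_Cc.

(** * Real algebra homomorphisms from [Cc] to the complex numbers *)

Section character.
Context (R : realType) (G : topologicalGroupType) (chi : (G -> R[i]) -> R[i]).
Hypothesis chiD : forall f g, Cc f -> Cc g -> chi (f \+ g) = chi f + chi g.
Hypothesis chiZ : forall (a : R) f, Cc f -> chi (fun x => a%:C * f x) = a%:C * chi f.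
Hypothesis chiM : forall f g, Cc f -> Cc g -> chi (f \* g) = chi f * chi g.

Let chi0 : chi (fun=> 0) = 0.
Proof.
have C0 : Cc (fun=> 0 : R[i]) := Cc_real (Ccr0 R G).
rewrite (_ : (fun=> 0) = (fun x => (0 : R)%:C * (fun=> 0) x)).
  by rewrite chiZ// mul0r.
by apply/funext => x; rewrite mulr0.
Qed.

(** Nonnegative functions cannot cancel, so a finite sum of them stays in the kernel and is positive
    wherever one term is. *)
Let character_kernel_sum (s : seq G) (F : G -> G -> R) :
  (forall p, [/\ Ccr (F p), forall x, 0 <= F p x & chi (fun x => (F p x)%:C) = 0]) ->
  exists S : G -> R,
    [/\ Ccr S, forall x, 0 <= S x, chi (fun x => (S x)%:C) = 0 &
        forall p x, p \in s -> 0 < F p x -> 0 < S x].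
Proof.
move=> HF; elim: s => [|p s [S [CS S0 chiS Spos]]].
  by exists (fun=> 0); split => //; exact: Ccr0.
have [CF F0 chiF] := HF p.
exists (fun x => F p x + S x); split.
- exact: CcrD.
- by move=> x; rewrite addr_ge0.
- rewrite (_ : (fun _ => _) = (fun x => (F p x)%:C) \+ (fun x => (S x)%:C)).
    by rewrite chiD ?chiF ?chiS ?addr0//; exact: Cc_real.
  by apply/funext => x; rewrite rmorphD.
- move=> q x; rewrite inE => /orP[/eqP ->|qs] Fx; first exact: ltr_pwDl.
  by rewrite ltr_wpDl//; exact: (Spos q).
Qed.

(* Otherwise finitely many [|f|^2] with [chi f = 0] add up to a function [S] that is
   positive on the support of [h], and [chi h = chi (S * (h / S)) = 0]. *)
Lemma character_kernel (h : G -> R[i]) : Cc h -> chi h != 0 ->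
  exists p, forall f, Cc f -> chi f = 0 -> f p = 0.
Proof.
move=> Ch chih; apply: contrapT => /forallNP noP.
have /choice[F HF] : forall p, exists F : G -> R,
    [/\ Ccr F, forall x, 0 <= F x, chi (fun x => (F x)%:C) = 0 & 0 < F p].
  move=> p; have /existsNP[f /not_implyP[Cf /not_implyP[chif fp]]] := noP p.
  have /CcP[f1 f2] := Cf.
  exists (fun x => complex.Re (f x) ^+ 2 + complex.Im (f x) ^+ 2); split.
  - by apply: CcrD; apply: CcrM => //; [case: f1|case: f2].
  - by move=> x; rewrite addr_ge0// sqr_ge0.
  - rewrite (_ : (fun _ => _) = f \* (fun x => conjc (f x))).
      by rewrite chiM ?chif ?mul0r//; exact: Cc_conj.
    by apply/funext => x; rewrite /= add_Re2_Im2 sqr_normc.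
  - rewrite -ltcR add_Re2_Im2 exprn_gt0// normr_gt0; exact/eqP.
have [ch kh] := Ch; set K := closure _ in kh.
have [s _ Ks] : finite_subset_cover [set: G] (fun p => [set x | 0 < F p x]) K.
  rewrite compact_cover in kh; apply: kh.
    move=> p _; have [[cF _] _ _ _] := HF p.
    apply: (@open_comp _ _ (F p) [set t | 0 < t]); last exact: open_gt.
    by move=> x _; exact: cF.
  by move=> x _; exists x => //=; have [] := HF x.
have [S [CS S0 chiS Spos]] := @character_kernel_sum (finmap.enum_fset s) F
  (fun p => let: And4 a b c _ := HF p in And3 a b c).
have KS x : K x -> 0 < S x by move=> /Ks[p /= ps]; exact: Spos.
have /CcP[h1 h2] := Ch.
have hK1 x : complex.Re (h x) != 0 -> h x != 0 by apply: contra_neq => ->.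
have hK2 x : complex.Im (h x) != 0 -> h x != 0 by apply: contra_neq => ->.
have CS' : continuous S by case: CS.
have q1 : Ccr (fun x => complex.Re (h x) / S x).
  by apply: Ccr_div => // x /(closureS hK1)/KS; rewrite lt0r => /andP[].
have q2 : Ccr (fun x => complex.Im (h x) / S x).
  by apply: Ccr_div => // x /(closureS hK2)/KS; rewrite lt0r => /andP[].
have Cq : Cc (fun x => (complex.Re (h x) / S x) +i* (complex.Im (h x) / S x)) by exact/CcP.
move/eqP: chih; apply.
have -> : h = (fun x => (S x)%:C) \*
    (fun x => (complex.Re (h x) / S x) +i* (complex.Im (h x) / S x)).
  apply/funext => x /=; apply/eqP; rewrite eq_complex /= !mul0r subr0 addr0.
  have [hx|hx] := eqVneq (h x) 0; first by rewrite hx /= !mul0r !mulr0 eqxx.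
  have Sx : S x != 0 by rewrite gt_eqF// KS//; exact: subset_closure.
  by rewrite ![S x * _]mulrC !mulfVK ?eqxx.
by rewrite chiM ?chiS ?mul0r//; exact: Cc_real.
Qed.

(** Let [u] and [v] be sent to 1 and ['i]. At the common zero [p] of the kernel, [f p] is a real
    combination of [u p] and [v p] with the coordinates of [chi f] as coefficients. Multiplicativity
    gives [u p = 1] and [v p ^ 2 = -1]; the two roots are the two cases. *)
Lemma character_eval : locally_compact_group G ->
  (forall z, exists2 f, Cc f & chi f = z) ->
  exists p, (forall f, Cc f -> chi f = f p) \/ (forall f, Cc f -> chi f = conjc (f p)).
Proof.
move=> lG surj.
have [u Cu chiu] := surj 1; have [v Cv chiv] := surj 'i.
have [|p kerp] := @character_kernel u Cu; first by rewrite chiu oner_neq0.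
exists p.
(* Subtracting from [f] the combination of [u] and [v] with the same image leaves an element of the
   kernel, which vanishes at [p]. *)
have evalE f : Cc f ->
    f p = (complex.Re (chi f))%:C * u p + (complex.Im (chi f))%:C * v p.
  move=> Cf; set a := complex.Re _; set b := complex.Im _.
  have Ca := CcZ (- a) Cu; have Cb := CcZ (- b) Cv.
  have := kerp (f \+ ((fun x => (- a)%:C * u x) \+ (fun x => (- b)%:C * v x))).
  rewrite !chiD ?chiZ ?chiu ?chiv //; try by apply: CcD => //; exact: CcD.
  move=> /(_ _ _)/= h; apply/eqP; rewrite -subr_eq0 opprD.
  rewrite -!mulNr -!rmorphN h//; first by apply: CcD => //; exact: CcD.
  rewrite (complexE (chi f)) -/a -/b mulr1 !rmorphN /= mulNr [_%:C * 'i]mulrC.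
  by rewrite addrACA !subrr addr0.
have uu : u p * u p = u p.
  by have := evalE _ (CcM Cu Cu); rewrite chiM// chiu mulr1 /= mul1r mul0r addr0.
have vu : v p * u p = v p.
  by have := evalE _ (CcM Cv Cu); rewrite chiM// chiu chiv mulr1 /= mul1r mul0r add0r.
have vv : v p * v p = - u p.
  have := evalE _ (CcM Cv Cv); rewrite chiM// chiv -expr2 sqr_i /= => ->.
  by rewrite oppr0 mul0r addr0 rmorphN mulN1r.
(* The idempotent [u p] is not 0: otherwise [v p] would be 0 too and every function would vanish at
   [p], even a bump there. *)
have u1 : u p = 1.
  have [u0|u0] := eqVneq (u p) 0; last by apply: (mulfI u0); rewrite uu mulr1.
  have [w [Cw _ wp _]] := @Ccr_bump R G p setT lG filterT.
  have v0 : v p = 0 by rewrite -vu u0 mulr0.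
  have := evalE _ (Cc_real Cw); rewrite u0 v0 !mulr0 addr0 => -[w0].
  by move: wp; rewrite w0 ltxx.
have : (v p - 'i) * (v p + 'i) = 0.
  by rewrite -subr_sqr sqr_i expr2 vv u1 opprK addNr.
move/eqP; rewrite mulf_eq0 subr_eq0 addr_eq0 => /orP[]/eqP vp; [left|right] => f Cf.
  by rewrite evalE// u1 vp mulr1 [_ * 'i]mulrC -complexE.
rewrite evalE// u1 vp mulr1.
by case: (chi f) => a b; apply/eqP; rewrite eq_complex /=; simpc.
Qed.

End character.

(** * Haar integral and convolution of real functions *)

Section haar_integral.
Context (R : realType) (G : topologicalGroupType).
Variable mu : {measure set (borel G) -> \bar R}.
Hypothesis lG : locally_compact_group G.
Hypothesis haar : left_haar_measure mu.
Implicit Types (u v w : G -> R).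

Lemma open_borel (U : set G) : open U -> measurable (U : set (borel G)).
Proof. by move=> oU; apply: sub_sigma_algebra. Qed.

Lemma closed_borel (A : set G) : closed A -> measurable (A : set (borel G)).
Proof.
move=> cA; rewrite -(setCK A); apply: measurableC; apply: open_borel.
exact: closed_openC.
Qed.

Lemma continuous_borel u : continuous u ->
  measurable_fun setT (u : borel G -> R).
Proof.
move=> /continuousP cu; apply: (measurability _ (RGenOpens.measurableE R)).
move=> _ [_ [a [b ->]] <-]; rewrite setTI; apply: open_borel.
by apply: cu; exact: interval_open.
Qed.

Lemma continuous_mulgl (a : G) : continuous (fun x : G => (a * x)%g).
Proof.
move=> x; apply: (@continuous2_cvg _ _ _ _ _ _ (fun=> a) id (fun x y => (x * y)%g)).
- exact: (@mulg_continuous G (a, x)).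
- exact: cvg_cst.
- exact: cvg_id.
Qed.

(** If [U] were null, any compact set would be covered by finitely many left translates of [U],
    hence null; inner regularity would then make the whole group null. *)
Lemma haar_open_gt0 (U : set G) : open U -> U !=set0 -> (0 < mu U)%E.
Proof.
move=> oU [x0 Ux0]; have [mu0 _ _ innerreg invar] := haar.
rewrite lt0e measure_ge0 andbT; apply/eqP => muU0.
move/eqP: mu0; apply; rewrite (innerreg _ openT); apply/eqP.
rewrite eq_le; apply/andP; split; last first.
  apply: ereal_sup_ubound; exists set0; last exact: measure0.
  by split => //; exact: compact0.
apply: ge_ereal_sup => _ [K [kK _] <-].
pose tU (a : G) : set G := [set (a * y)%g | y in U].
have tUE a : tU a = (fun x => (a^-1 * x)%g) @^-1` U.
  apply/seteqP; split => [_ [y Uy <-]|y /= Uy]; first by rewrite /= mulKg.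
  by exists (a^-1 * y)%g => //; rewrite mulVKg.
have otU a : open (tU a).
  by rewrite tUE; apply: open_comp => // x _; exact: continuous_mulgl.
have [s _ Ks] : finite_subset_cover [set: G] tU K.
  rewrite compact_cover in kK; apply: kK => // x _.
  by exists (x * x0^-1)%g => //; exists x0 => //; rewrite mulgVK.
suff muK0 : mu K = 0%E by rewrite muK0.
apply: measure_negligible.
  by apply: closed_borel; apply: compact_closed => //; case: lG.
apply: (@negligibleS _ (borel G) R mu _ _ Ks); rewrite /cover bigcup_fset; elim/big_ind : _.
- exact: negligible_set0.
- by move=> ? ?; exact: negligibleU.
- move=> a _; apply/negligibleP; first exact: open_borel.
  by rewrite -[RHS]muU0; apply: invar; exact: open_borel.
Qed.

(** On its support, a compact set of finite measure, [u] is bounded; elsewhere it is 0. *)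
Lemma Ccr_integrable u : Ccr u -> mu.-integrable setT (EFin \o u : borel G -> \bar R).
Proof.
move=> [cu ku]; set K := closure _ in ku.
have mK : measurable (K : set (borel G)) by apply: closed_borel; exact: closed_closure.
rewrite (_ : EFin \o _ = (EFin \o (u : borel G -> R)) \_ K).
  apply/(integrable_mkcond _ mK); apply: measurable_bounded_integrable => //.
  - by case: haar => _ + _ _ _; apply.
  - by apply: measurable_funTS; exact: continuous_borel.
  - have /compact_bounded[M [Mr HM]] : compact (u @` K).
      by apply: continuous_compact => //; exact: continuous_subspaceT.
    by exists M; split => // r Mr' x Kx; apply: HM => //; exists x.
apply/funext => x; rewrite patchE /=; case: ifPn => //.
rewrite notin_setE => nKx; congr EFin; apply: contrapT => /eqP ux.
by apply: nKx; exact: subset_closure.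
Qed.

(** With [c] half of [u x0], the integral is at least [c] times the measure of the nonempty open set
    where [u > c]. *)
Lemma Ccr_integral_gt0 u (x0 : G) : Ccr u -> (forall x, 0 <= u x) -> 0 < u x0 ->
  0 < \int[mu]_x u x.
Proof.
move=> Cu u0 ux0; have [cu _] := Cu.
have iu := Ccr_integrable Cu.
have c0 : 0 < u x0 / 2 by rewrite divr_gt0.
set c := u x0 / 2 in c0.
set U : set G := [set x | c < u x].
have oU : open U by apply: (@open_comp _ _ u [set t | c < t]) => [x _|]; [exact: cu|exact: open_gt].
have Ux0 : U x0 by rewrite /U /c /= ltr_pdivrMr// ltr_pMr// ltr1n.
have mU := open_borel oU.
have mu_u := continuous_borel cu.
(* The real integral is the [fine] part of the extended one, so finiteness is needed besides
   positivity. *)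
apply: fine_gt0; apply/andP; split; last first.
  by have := integrable_fin_num measurableT iu; rewrite fin_numE ltey => /andP[].
apply: (@lt_le_trans _ _ (c%:E * mu U)%E).
  by rewrite mule_gt0//; apply: haar_open_gt0 => //; exists x0.
rewrite -integral_cst//.
apply: (@le_trans _ _ (\int[mu]_(x in U) (u x)%:E)%E).
  apply: ge0_le_integral => //.
  - by move=> x _; rewrite lee_fin ltW.
  - by apply/measurable_EFinP; exact: measurable_funTS.
  - by move=> x Ux; rewrite lee_fin ltW.
apply: ge0_subset_integral => //; first exact/measurable_EFinP.
by move=> x _; rewrite lee_fin.
Qed.

Definition rconv u v : G -> R := fun x => \int[mu]_y (u (x * y^-1)%g * v y).

Lemma Ccr_conv_integrand u v (x : G) : continuous u -> Ccr v ->
  Ccr (fun y => u (x * y^-1)%g * v y).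
Proof.
move=> cu Cv; rewrite (_ : (fun _ => _) = (fun y => v y * u (x * y^-1)%g)).
  apply: CcrM => // y; apply: (@continuous_comp _ _ _ (fun y => (x * y^-1)%g) u).
    apply: (@continuous_comp _ _ _ (fun y => (y^-1)%g) (fun z => (x * z)%g)).
      exact: invg_continuous.
    exact: continuous_mulgl.
  exact: cu.
by apply/funext => y; rewrite mulrC.
Qed.

(** For [x] near [x0] the left factors differ by less than [d] uniformly on the support of [v], so
    the convolutions differ by at most [d] times the integral of [|v|]. *)
Lemma rconv_continuous u v : continuous u -> Ccr v -> continuous (rconv u v).
Proof.
move=> cu Cv; have [cv kv] := Cv.
have Cav : Ccr (fun y => `|v y|).
  split; first by move=> y; apply: cvg_norm; exact: cv.
  by apply: sub_compact_closure kv => y /=; rewrite normr_eq0.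
set B := \int[mu]_y `|v y|.
have B0 : 0 <= B by apply: Rintegral_ge0.
move=> x0; apply/cvgrPdist_lt => e e0.
(* The integral [B] may be 0, hence the added 1. *)
have B1 : 0 < B + 1 by rewrite ltr_wpDl.
have d0 : 0 < e / (B + 1) by rewrite divr_gt0.
set d := e / (B + 1) in d0.
(* Joint continuity gives closeness near each pair [(y, x0)]; compactness of the support makes it
   uniform in [y]. *)
have unif : \forall x \near x0, closure [set y | v y != 0] `<=`
    [set y | `|u (x0 * y^-1)%g - u (x * y^-1)%g| < d].
  move/compact_near_coveringP : kv; apply => y _.
  have cxy (z : G * G) : {for z, continuous (fun p : G * G => u (p.2 * p.1^-1)%g)}.
    apply: (@continuous_comp _ _ _ (fun p : G * G => (p.2 * p.1^-1)%g) u); last exact: cu.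
    apply: (@continuous2_cvg _ _ _ _ _ _ snd (fun p => p.1^-1)%g (fun x y => (x * y)%g)).
    - exact: (@mulg_continuous G (_, _)).
    - exact: cvg_snd.
    - apply: (@cvg_comp _ _ _ fst (fun x => x^-1)%g); first exact: cvg_fst.
      exact: invg_continuous.
  have d2 : 0 < d / 2 by rewrite divr_gt0.
  have /cvgrPdist_lt/(_ _ d2) h := cxy (y, x0).
  have cy : continuous (fun y : G => u (x0 * y^-1)%g).
    move=> t; apply: (@continuous_comp _ _ _ (fun t => (t, x0))
      (fun p : G * G => u (p.2 * p.1^-1)%g)).
      by apply: cvg_pair; [exact: cvg_id|exact: cvg_cst].
    exact: cxy.
  have /cvgrPdist_lt/(_ _ d2) h' := cy y.
  have h'' : \forall p \near (y, x0), `|u (x0 * y^-1)%g - u (x0 * p.1^-1)%g| < d / 2.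
    exact: (cvg_fst h').
  near=> p => /=.
  rewrite (splitr d) (@le_lt_trans _ _ (`|u (x0 * y^-1)%g - u (x0 * p.1^-1)%g|
     + `|u (x0 * y^-1)%g - u (p.2 * p.1^-1)%g|))//; last first.
    by rewrite ltrD//; near: p.
  by rewrite [leRHS]addrC -[`|_ - u (x0 * p.1^-1)%g|]distrC [leRHS]addrC ler_distD.
near=> x.
have I t := Ccr_integrable (Ccr_conv_integrand t cu Cv).
rewrite /rconv -RintegralB//.
have CB : Ccr (fun y => (u (x0 * y^-1)%g * v y - u (x * y^-1)%g * v y)).
  have := CcrD (Ccr_conv_integrand x0 cu Cv) (CcrZ (-1) (Ccr_conv_integrand x cu Cv)).
  by congr (Ccr _); apply/funext => y; rewrite mulN1r.
have CaB : Ccr (fun y => `|u (x0 * y^-1)%g * v y - u (x * y^-1)%g * v y|).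
  split; first by move=> y; apply: cvg_norm; case: CB => + _; exact.
  by case: CB => _; apply: sub_compact_closure => y /=; rewrite normr_eq0.
apply: le_lt_trans (le_normr_Rintegral measurableT (Ccr_integrable CB)) _.
apply: (@le_lt_trans _ _ (\int[mu]_y (d * `|v y|))).
  apply: le_Rintegral => //; [exact: Ccr_integrable|exact/Ccr_integrable/CcrZ|].
  move=> y _; rewrite -mulrBl normrM; have [->|vy] := eqVneq (v y) 0.
    by rewrite normr0 !mulr0.
  rewrite ler_wpM2r// ltW//.
  suff : closure [set y | v y != 0] y by move: (y); near: x.
  exact: subset_closure.
rewrite RintegralZl//; last exact: Ccr_integrable.
by rewrite -/B /d mulrAC ltr_pdivrMr// ltr_pM2l// ltrDl.
Unshelve. all: by end_near. Qed.

(** Since [x = (x * y^-1) * y], the convolution vanishes off the product of the two supports, a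
    continuous image of a compact set. *)
Lemma rconv_Ccr u v : Ccr u -> Ccr v -> Ccr (rconv u v).
Proof.
move=> [cu ku] Cv; split; first exact: rconv_continuous.
have [cv kv] := Cv.
set Ku := closure _ in ku; set Kv := closure _ in kv.
have kuv : compact ((fun p : G * G => (p.1 * p.2)%g) @` (Ku `*` Kv)).
  apply: continuous_compact; last exact: compact_setX.
  by apply: continuous_subspaceT; exact: mulg_continuous.
have cuv := compact_closed (proj1 lG) kuv.
rewrite ((closure_id _).1 cuv) in kuv; apply: sub_compact_closure kuv => x /= xuv.
apply: contrapT => nx; move/eqP: xuv; apply.
rewrite /rconv (_ : (fun _ => _) = (fun=> 0)).
  by rewrite Rintegral_cst// mul0r.
apply/funext => y; have [->|vy] := eqVneq (v y) 0; first by rewrite mulr0.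
have [->|uy] := eqVneq (u (x * y^-1)%g) 0; first by rewrite mul0r.
exfalso; apply: nx; exists ((x * y^-1)%g, y); last by rewrite /= mulgVK.
by split; exact: subset_closure.
Qed.

End haar_integral.

(** * The point map of a pointwise isomorphism *)

Section point_map.
Context (R : realType).

(** The alternative may depend on [y]; only the convolution will make it uniform. *)
Definition point_map (G H : topologicalGroupType)
    (T : (G -> R[i]) -> H -> R[i]) (psi : H -> G) :=
  forall y, (forall f, Cc f -> T f y = f (psi y)) \/
            (forall f, Cc f -> T f y = conjc (f (psi y))).

Context (G H : topologicalGroupType).
Hypothesis lG : locally_compact_group G.
Hypothesis lH : locally_compact_group H.
Variable T : (G -> R[i]) -> H -> R[i].
Implicit Types (psi : H -> G) (u v : G -> R).

Lemma exists_point_map :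
  algebra_isomorphism (@Cc R G) (@pointwise_product R G)
                      (@Cc R H) (@pointwise_product R H) T ->
  exists psi, point_map T psi.
Proof.
move=> [[_ _ surjT] TD TZ TM]; suff /choice[psi Hpsi] : forall y, exists p,
    (forall f, Cc f -> T f y = f p) \/ (forall f, Cc f -> T f y = conjc (f p)).
  by exists psi.
move=> y.
apply: (@character_eval R G (fun f => T f y)) => //.
- by move=> f g Cf Cg; rewrite TD.
- by move=> a f Cf; rewrite TZ.
- by move=> f g Cf Cg; rewrite (TM f g Cf Cg).
(* A bump at [y], rescaled to take the value [z] there, has a preimage under [T]. *)
- move=> z; have [u [Cu _ uy _]] := @Ccr_bump R H y setT lH filterT.
  have uy0 : u y != 0 by rewrite gt_eqF.
  have Cg : Cc (fun x => (complex.Re z / u y * u x) +i* (complex.Im z / u y * u x)).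
    by apply/CcP; split; exact: CcrZ.
  have [f Cf Tf] := surjT _ Cg.
  by exists f => //; rewrite Tf !divfK//; case: (z).
Qed.

Variable psi : H -> G.
Hypothesis Tpsi : point_map T psi.
Hypothesis TCc : forall f, Cc f -> Cc (T f).

(** Conjugation fixes real values, so both alternatives agree on real functions. *)
Lemma point_map_real u y : Ccr u -> T (fun x => (u x)%:C) y = (u (psi y))%:C.
Proof.
by move=> /Cc_real Cu; have [->|->] := Tpsi y => //; rewrite conjc_real.
Qed.

Lemma point_map_Ccr u : Ccr u -> Ccr (u \o psi).
Proof.
move=> Cu; have /CcP[+ _] := TCc (Cc_real Cu).
by congr (Ccr _); apply/funext => y; rewrite point_map_real.
Qed.

(** For a bump [u] at [psi y] supported in [U], the continuous function [u \o psi] is positive near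
    [y], and [psi] maps the points where it is positive into [U]. *)
Lemma point_map_continuous : continuous psi.
Proof.
move=> y U /(Ccr_bump R lG)[u [Cu _ uy uU]].
have [cu _] := point_map_Ccr Cu.
apply: (@filterS _ (nbhs y) _ [set z | 0 < (u \o psi) z]).
  by move=> z /= uz; apply: uU; rewrite gt_eqF.
apply: open_nbhs_nbhs; split => //.
by apply: (@open_comp _ _ (u \o psi) [set t | 0 < t]) => [x _|]; [exact: cu|exact: open_gt].
Qed.

(** Otherwise take a bump [v] at [y] that vanishes at [phi (psi y)]: then [T' v] vanishes at
    [psi y], so [T (T' v) = v] vanishes at [y]. *)
Lemma point_map_cancel (T' : (H -> R[i]) -> G -> R[i]) (phi : G -> H) :
  point_map T' phi -> (forall g, Cc g -> Cc (T' g) /\ T (T' g) = g) ->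
  cancel psi phi.
Proof.
move=> T'phi TT' y; apply: contrapT => /eqP neq.
have yN : nbhs y (~` [set phi (psi y)]).
  apply: open_nbhs_nbhs; split; last by move=> /= yE; rewrite -yE eqxx in neq.
  apply: closed_openC; apply: accessible_closed_set1.
  by apply: hausdorff_accessible; case: lH.
have [v [Cv _ vy vN]] := Ccr_bump R lH yN.
have vphi : v (phi (psi y)) = 0.
  by apply: contrapT => /eqP /vN; exact.
have [CT' TT'v] := TT' _ (Cc_real Cv).
have T'0 : T' (fun x => (v x)%:C) (psi y) = 0.
  have [->|->] := T'phi (psi y); rewrite ?vphi ?conjc0//; exact: Cc_real.
have : T (T' (fun x => (v x)%:C)) y = 0.
  by have [->|->] := Tpsi y => //; rewrite T'0 ?conjc0.
by rewrite TT'v => -[v0]; rewrite v0 ltxx in vy.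
Qed.

End point_map.

(** Provides the inverse isomorphism whose point map will invert [psi]; its laws follow from those
    of [T] by injectivity. *)
Lemma pointwise_isomorphism_inverse (R : realType) (G H : topologicalGroupType)
    (T : (G -> R[i]) -> H -> R[i]) :
  algebra_isomorphism (@Cc R G) (@pointwise_product R G)
                      (@Cc R H) (@pointwise_product R H) T ->
  exists T', [/\ algebra_isomorphism (@Cc R H) (@pointwise_product R H)
                                     (@Cc R G) (@pointwise_product R G) T',
     forall f, Cc f -> T' (T f) = f &
     forall g, Cc g -> Cc (T' g) /\ T (T' g) = g].
Proof.
move=> [[TCc injT surjT] TD TZ TM].
have /choice[T' HT'] : forall g, exists f, Cc g -> Cc f /\ T f = g.
  (* Outside [Cc] the value 0 is an arbitrary default. *)
  move=> g; have [Cg|nCg] := pselect (Cc g); last by exists (fun=> 0).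
  by have [f Cf Tf] := surjT _ Cg; exists f.
have T'E f g : Cc f -> Cc g -> T f = g -> T' g = f.
  move=> Cf Cg Tf; have [CT' TT'] := HT' g Cg.
  by apply: injT; rewrite ?inE// TT'.
have T'T f : Cc f -> T' (T f) = f by move=> Cf; apply: T'E => //; exact: TCc.
exists T'; split => //; split.
- split.
  + by move=> g /HT'[].
  + by move=> g1 g2 /set_mem/HT'[_ T1] /set_mem/HT'[_ T2] g12; rewrite -T1 g12 T2.
  + by move=> f Cf; exists (T f); [exact: TCc|exact: T'T].
- move=> f g /[dup] Cf /HT'[? Tf] /[dup] Cg /HT'[? Tg].
  by apply: T'E; [exact: CcD|exact: CcD|rewrite TD// Tf Tg].
- move=> a f /[dup] Cf /HT'[? Tf].
  by apply: T'E; [exact: CcZ|exact: CcZ|rewrite TZ// Tf].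
- move=> f g /[dup] Cf /HT'[? Tf] /[dup] Cg /HT'[? Tg].
  by apply: T'E; [exact: CcM|exact: CcM|rewrite TM// Tf Tg].
Qed.

(** * Reduction of convolutions to real integrals *)

Section convolution.
Context (R : realType) (G : topologicalGroupType).
Variable mu : {measure set (borel G) -> \bar R}.
Implicit Types (u v : G -> R).

Lemma convolution_real u v :
  convolution mu (fun x => (u x)%:C) (fun x => (v x)%:C) =
  (fun x => (rconv mu u v x)%:C).
Proof.
apply/funext => x; rewrite /convolution /complex_integral /rconv.
congr (_ +i* _).
  by congr (Rintegral _ _ _); apply/funext => y /=; rewrite mul0r subr0.
rewrite (_ : (fun _ => _) = (fun=> 0)) ?Rintegral_cst ?mul0r//.
by apply/funext => y /=; rewrite mulr0 mul0r addr0.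
Qed.

Lemma convolution_imaginary u v :
  convolution mu (fun x => 0 +i* u x) (fun x => (v x)%:C) =
  (fun x => 0 +i* rconv mu u v x).
Proof.
apply/funext => x; rewrite /convolution /complex_integral /rconv.
congr (_ +i* _).
  rewrite (_ : (fun _ => _) = (fun=> 0)) ?Rintegral_cst ?mul0r//.
  by apply/funext => y /=; rewrite mulr0 mul0r subr0.
by congr (Rintegral _ _ _); apply/funext => y /=; rewrite mul0r add0r.
Qed.

End convolution.

(** * Multiplicativity of the point map and uniformity of the alternative *)

Section convolution_point_map.
Context (R : realType) (G H : topologicalGroupType).
Hypothesis lG : locally_compact_group G.
Hypothesis lH : locally_compact_group H.
Variables (muG : {measure set (borel G) -> \bar R})
          (muH : {measure set (borel H) -> \bar R}).
Hypothesis haarG : left_haar_measure muG.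
Hypothesis haarH : left_haar_measure muH.
Variables (T : (G -> R[i]) -> H -> R[i]) (psi : H -> G) (phi : G -> H).
Hypothesis TCc : forall f, Cc f -> Cc (T f).
Hypothesis TM : forall f g, Cc f -> Cc g ->
  T (convolution muG f g) = convolution muH (T f) (T g).
Hypothesis Tpsi : point_map T psi.
Hypothesis psiK : cancel psi phi.
Hypothesis psi_cont : continuous psi.
Hypothesis phi_cont : continuous phi.
Implicit Types (u v : G -> R).

(** On real functions [T] is composition with [psi]; evaluating its compatibility with convolution
    at [x] relates the two Haar integrals. *)
Lemma rconv_point_map u v (x : H) : Ccr u -> Ccr v ->
  rconv muG u v (psi x) = rconv muH (u \o psi) (v \o psi) x.
Proof.
move=> Cu Cv.
have := congr1 (fun f => f x) (TM (Cc_real Cu) (Cc_real Cv)).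
rewrite convolution_real (point_map_real Tpsi); last exact: rconv_Ccr.
have TE w : Ccr w -> T (fun x => (w x)%:C) = (fun y => ((w \o psi) y)%:C).
  by move=> Cw; apply/funext => y; rewrite (point_map_real Tpsi).
by rewrite !TE// convolution_real => -[].
Qed.

(* If the two points differ, let [u] be a bump at the first one vanishing at the
   second one, and [v] a bump near [y]: one of the two convolutions is positive at
   [psi x] while the other one vanishes. *)
Lemma point_map_mulgV (x : H) (y : G) : (psi x * y^-1)%g = psi (x * (phi y)^-1)%g.
Proof.
apply: contrapT => /eqP neq.
set p := (psi x * y^-1)%g in neq *; set q := psi _ in neq *.
have [U [V [pU qV UV0]]] : exists U V, [/\ nbhs p U, nbhs q V & U `&` V = set0].
  have [+ _] := lG; rewrite open_hausdorff => /(_ _ _ neq)[[U V] /= [pU qV] [oU oV /eqP UV]].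
  exists U, V; split => //; apply: open_nbhs_nbhs; split => //; exact/set_mem.
have [u [Cu u0 up uU]] := Ccr_bump R lG pU.
(* Where [v] is nonzero, [psi (x * (phi z)^-1)] stays in [V], hence outside [U], where [u]
   vanishes. *)
have yV : nbhs y [set z | V (psi (x * (phi z)^-1)%g)].
  have : continuous (fun z : G => psi (x * (phi z)^-1)%g).
    move=> z; apply: (@continuous_comp _ _ _ (fun z => x * (phi z)^-1)%g psi); last exact: psi_cont.
    apply: (@continuous_comp _ _ _ (fun z => (phi z)^-1)%g (fun t => x * t)%g); last first.
      exact: continuous_mulgl.
    apply: (@continuous_comp _ _ _ phi (fun t => t^-1)%g); first exact: phi_cont.
    exact: invg_continuous.
  by apply.
have [v [Cv v0 vy vV]] := Ccr_bump R lG yV.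
have := rconv_point_map x Cu Cv.
have -> : rconv muH (u \o psi) (v \o psi) x = 0.
  rewrite /rconv (_ : (fun _ => _) = (fun=> 0)) ?Rintegral_cst ?mul0r//.
  apply/funext => t /=; have [->|/vV/=] := eqVneq (v (psi t)) 0.
    by rewrite mulr0.
  rewrite psiK => Vt; have [->|/uU Ut] := eqVneq (u (psi (x * t^-1)%g)) 0.
    by rewrite mul0r.
  by have : (U `&` V) (psi (x * t^-1)%g) by []; rewrite UV0.
move=> uv0; have [cu _] := Cu.
have : 0 < rconv muG u v (psi x).
  apply: (Ccr_integral_gt0 lG haarG (x0 := y)).
  - exact: Ccr_conv_integrand.
  - by move=> t; rewrite mulr_ge0.
  - by rewrite mulr_gt0.
by rewrite uv0 ltxx.
Qed.

(** Taking [y] in the image of [psi] shows that [psi] preserves right quotients, hence the unit,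
    inverses and products. *)
Lemma point_map_mulg (x y : H) : psi (x * y)%g = (psi x * psi y)%g.
Proof.
have psiV (a b : H) : psi (a * b^-1)%g = (psi a * (psi b)^-1)%g.
  by rewrite point_map_mulgV psiK.
have psi1 : psi 1%g = 1%g by rewrite -(mulgV 1%g) psiV mulgV.
by rewrite -[in LHS](invgK y) psiV -[(y^-1)%g]mul1g psiV psi1 mul1g invgK.
Qed.

(** The sign by which [T] acts at [y] on imaginary functions; no continuity is assumed of it. *)
Let s (y : H) : R := if `[< forall f, Cc f -> T f y = f (psi y) >] then 1 else -1.

Lemma point_map_imaginary u y : Ccr u ->
  T (fun x => 0 +i* u x) y = 0 +i* (u (psi y) * s y).
Proof.
move=> /Cc_imaginary Cu; rewrite /s; case: asboolP => [->//|nT].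
  by rewrite mulr1.
by have [//|->//] := Tpsi y; rewrite mulrN1.
Qed.

(** Suppose the sign is 1 at [a] and -1 at [b]. Convolving an imaginary function with a real one and
    evaluating at [a] makes the integral of a nonnegative function, weighted by [1 - s], equal to 0;
    yet the weight is 2 at [b]. *)
Lemma point_map_conj :
  (forall f, Cc f -> forall y : H, T f y = conjc (f (psi y))) \/
  (forall f, Cc f -> forall y : H, T f y = f (psi y)).
Proof.
have [all1|/existsNP[b nb]] := pselect (forall y f, Cc f -> T f y = f (psi y)).
  by right=> f Cf y; exact: all1.
have [all2|/existsNP[a na]] := pselect (forall y f, Cc f -> T f y = conjc (f (psi y))).
  by left=> f Cf y; exact: all2.
exfalso.
have sa : s a = 1 by rewrite /s; case: asboolP => // n; case: (Tpsi a).
have sb : s b = -1 by rewrite /s; case: asboolP.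
(* Chosen so that [a * y0^-1 = b]: at [y0] the left factor is evaluated at [b]. *)
set y0 := (b^-1 * a)%g.
have [u [Cu u0 ub _]] := @Ccr_bump R G (psi b) setT lG filterT.
have [v [Cv v0 vy _]] := @Ccr_bump R G (psi y0) setT lG filterT.
have Cw := point_map_Ccr Tpsi TCc Cu; have Cz := point_map_Ccr Tpsi TCc Cv.
set w := u \o psi in Cw; set z := v \o psi in Cz.
(* This product is the imaginary part of an image under [T], hence continuous although [s] is not
   known to be. *)
have Csw : Ccr (fun y => w y * s y).
  have /CcP[_] := TCc (Cc_imaginary Cu); congr (Ccr _); apply/funext => y.
  by rewrite point_map_imaginary.
have eq_a : rconv muH w z a = rconv muH (fun y => w y * s y) z a.
  have := congr1 (fun f => f a) (TM (Cc_imaginary Cu) (Cc_real Cv)).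
  rewrite convolution_imaginary point_map_imaginary; last exact: rconv_Ccr.
  rewrite sa mulr1 (rconv_point_map _ Cu Cv).
  have -> : T (fun x => (v x)%:C) = (fun y => (z y)%:C).
    by apply/funext => y; rewrite (point_map_real Tpsi).
  have -> : T (fun x => 0 +i* u x) = (fun y => 0 +i* (w y * s y)).
    by apply/funext => y; rewrite point_map_imaginary.
  by rewrite convolution_imaginary => -[].
have [cw _] := Cw; have [csw _] := Csw.
have C1 := Ccr_conv_integrand a cw Cz.
have C2 := Ccr_conv_integrand a csw Cz.
have : 0 < \int[muH]_y (w (a * y^-1)%g * z y - w (a * y^-1)%g * s (a * y^-1)%g * z y).
  apply: (Ccr_integral_gt0 lH haarH (x0 := y0)).
  - by have := CcrD C1 (CcrZ (-1) C2); congr (Ccr _); apply/funext => y; rewrite mulN1r.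
  - move=> y; rewrite -mulrBl mulr_ge0 ?v0// subr_ge0 ler_piMr ?u0//.
    by rewrite /s; case: ifP => // _; rewrite (le_trans _ ler01)// lerN10.
  - have -> : (a * y0^-1)%g = b by rewrite /y0 invgM invgK mulgA mulgV mul1g.
    by rewrite sb -mulrBl mulrN1 opprK mulr_gt0// addr_gt0.
rewrite RintegralB//; [|exact: Ccr_integrable..].
by rewrite -/(rconv muH w z a) -/(rconv muH (fun y => w y * s y) z a) eq_a subrr ltxx.
Qed.

End convolution_point_map.

(** * The point maps of [T] and its inverse as mutually inverse homeomorphisms *)

Theorem theorem1p10 (R : realType) (G H : topologicalGroupType)
    (hG : locally_compact_group G) (hH : locally_compact_group H)
    (muG : {measure set (borel G) -> \bar R})
    (muH : {measure set (borel H) -> \bar R})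
    (hmuG : left_haar_measure muG) (hmuH : left_haar_measure muH)
    (T : (G -> R[i]) -> (H -> R[i]))
    (Tpointwise : algebra_isomorphism
       (@Cc R G) (@pointwise_product R G) (@Cc R H) (@pointwise_product R H) T)
    (Tconvolution : algebra_isomorphism
       (@Cc R G) (convolution muG) (@Cc R H) (convolution muH) T) :
  exists psi : H -> G, multiplicative_homeomorphism psi /\
    ((forall f, Cc f -> forall y : H, T f y = conjc (f (psi y))) \/
     (forall f, Cc f -> forall y : H, T f y = f (psi y))).
Proof.
have [psi Tpsi] := exists_point_map hG hH Tpointwise.
have [T' [T'iso T'T TT']] := pointwise_isomorphism_inverse Tpointwise.
have [phi T'phi] := exists_point_map hH hG T'iso.
have [[TCc _ _] _ _ _] := Tpointwise.
have [[T'Cc _ _] _ _ _] := T'iso.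
have psiK : cancel psi phi by apply: (point_map_cancel hH Tpsi T'phi).
have phiK : cancel phi psi.
  by apply: (point_map_cancel hG T'phi Tpsi) => f Cf; split; [exact: TCc|exact: T'T].
have psi_cont := point_map_continuous hG Tpsi TCc.
have phi_cont := point_map_continuous hH T'phi T'Cc.
have [_ _ _ TM] := Tconvolution.
exists psi; split.
  split; first by split=> //; exists phi.
  exact: (point_map_mulg hG hmuG TM Tpsi psiK).
exact: (point_map_conj hG hH hmuG hmuH TCc TM Tpsi).
Qed.
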